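(* Let $I_1,I_2\subset\mathbf{R}$ be open intervals, let $\gamma=(\gamma_1,\gamma_2):I_1\to S^3$ be a unit speed Legendre curve in $S^3$ and $\alpha=(\alpha_1,\alpha_2):I_2\to H^3_1$ a unit speed Legendre curve in $H^3_1$, such that the map $$\phi:I_2\times I_1\to\mathbf{C}^2,\qquad \phi(t,s)=(\alpha_1(t)\gamma_1(s),\,\alpha_2(t)\gamma_2(s)),$$ is a (Lagrangian conformal) immersion. Then the Lagrangian angle map $\beta_\phi$ of $\phi$ and the Legendre angles $\theta_\gamma$ and $\theta_\alpha$ of $\gamma$ and $\alpha$ are related by $$\beta_\phi(t,s)=\theta_\gamma(s)+\theta_\alpha(t)+\pi\pmod{2\pi}.$$
   Context: Curves are smooth. $S^3=\{(z,w)\in\mathbf{C}^2:|z|^2+|w|^2=1\}$. A unit speed Legendre curve $\gamma$ in $S^3$ satisfies $|\gamma_1|^2+|\gamma_2|^2=1$, $|\gamma_1'|^2+|\gamma_2'|^2=1$, $\gamma_1'\bar\gamma_1+\gamma_2'\bar\gamma_2=0$. $H^3_1=\{(z,w)\in\mathbf{C}^2:|z|^2-|w|^2=-1\}$. A unit speed Legendre curve $\alpha$ in $H^3_1$ satisfies $|\alpha_1|^2-|\alpha_2|^2=-1$, $|\alpha_1'|^2-|\alpha_2'|^2=1$, $\alpha_1'\bar\alpha_1-\alpha_2'\bar\alpha_2=0$. The metric induced by $\phi$ from the Euclidean metric is $(|\gamma_1|^2+|\alpha_1|^2)(dt^2+ds^2)$, so $\phi$ is an immersion exactly when $|\gamma_1(s)|^2+|\alpha_1(t)|^2\neq0$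 everywhere. The Legendre angles are defined (mod $2\pi$) by $$e^{i\theta_\gamma}=\det{}_{\mathbf{C}}(\gamma,\gamma')=\gamma_1\gamma_2'-\gamma_1'\gamma_2,\qquad e^{i\theta_\alpha}=\det{}_{\mathbf{C}}(\alpha,\alpha')=\alpha_1\alpha_2'-\alpha_1'\alpha_2.$$ The Lagrangian angle map $\beta_\phi$ (with values in $\mathbf{R}/2\pi\mathbf{Z}$) is defined by $e^{i\beta_\phi}=\det_{\mathbf{C}}(\phi_*e_1,\phi_*e_2)$, where $e_1,e_2$ is any oriented orthonormal basis of the surface, oriented by $(\partial_t,\partial_s)$. *)

(* Defs.v *)
From Stdlib Require Import Reals.
From Coquelicot Require Import Coquelicot.

Open Scope R_scope.

(** Endpoints may be infinite. *)
Definition Rbar_interval (a b : Rbar) (x : R) : Prop :=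
  Rbar_lt a x /\ Rbar_lt x b.

(** Curves are total functions on [R]. All conditions are imposed on an open
    interval only, so the values outside it are irrelevant. *)

Definition smooth_on (I : R -> Prop) (f : R -> R) : Prop :=
  forall (n : nat) (x : R), I x -> ex_derive_n f n x.

Definition Csmooth_on (I : R -> Prop) (f : R -> C) : Prop :=
  smooth_on I (fun x => Re (f x)) /\ smooth_on I (fun x => Im (f x)).

Definition C2smooth_on (I : R -> Prop) (c : R -> C * C) : Prop :=
  Csmooth_on I (fun x => fst (c x)) /\ Csmooth_on I (fun x => snd (c x)).

(** Derivative with respect to a real variable. *)
Definition CDerive (f : R -> C) (x : R) : C :=
  (Derive (fun u => Re (f u)) x, Derive (fun u => Im (f u)) x).

Definition C2Derive (c : R -> C * C) (x : R) : C * C :=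
  (CDerive (fun u => fst (c u)) x, CDerive (fun u => snd (c u)) x).

Definition legendre_S3 (I : R -> Prop) (c : R -> C * C) : Prop :=
  C2smooth_on I c /\
  forall s : R, I s ->
    let (c1, c2) := c s in
    let (d1, d2) := C2Derive c s in
    Cmod c1 ^ 2 + Cmod c2 ^ 2 = 1 /\
    Cmod d1 ^ 2 + Cmod d2 ^ 2 = 1 /\
    (d1 * Cconj c1 + d2 * Cconj c2)%C = RtoC 0.

Definition legendre_H31 (I : R -> Prop) (c : R -> C * C) : Prop :=
  C2smooth_on I c /\
  forall t : R, I t ->
    let (c1, c2) := c t in
    let (d1, d2) := C2Derive c t in
    Cmod c1 ^ 2 - Cmod c2 ^ 2 = -1 /\
    Cmod d1 ^ 2 - Cmod d2 ^ 2 = 1 /\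
    (d1 * Cconj c1 - d2 * Cconj c2)%C = RtoC 0.

Definition detC (u v : C * C) : C := (fst u * snd v - fst v * snd u)%C.

(** [expi x] is the complex number e^{ix}. *)
Definition expi (x : R) : C := (cos x, sin x).

(** An angle with values in R/2piZ is represented by the predicate of its real
    representatives, two of which are related by [eq_mod_2PI]. *)
Definition eq_mod_2PI (x y : R) : Prop :=
  exists k : Z, x = y + 2 * PI * IZR k.

Definition legendre_angle (c : R -> C * C) (x theta : R) : Prop :=
  expi theta = detC (c x) (C2Derive c x).

(** The differential of [phi] at [(t, s)], applied to the tangent vector
    [fst e * d/dt + snd e * d/ds]. *)
Definition push (phi : R -> R -> C * C) (t s : R) (e : R * R) : C * C :=
  let dt := C2Derive (fun u => phi u s) t in
  let ds := C2Derive (fun u => phi t u) s in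
  ((RtoC (fst e) * fst dt + RtoC (snd e) * fst ds)%C,
   (RtoC (fst e) * snd dt + RtoC (snd e) * snd ds)%C).

Definition immersion (I J : R -> Prop) (phi : R -> R -> C * C) : Prop :=
  forall t s : R, I t -> J s ->
    forall e : R * R, push phi t s e = (RtoC 0, RtoC 0) -> e = (0, 0).

Definition euclidean (u v : C * C) : R :=
  Re (fst u * Cconj (fst v) + snd u * Cconj (snd v))%C.

Definition induced_metric (phi : R -> R -> C * C) (t s : R) (e f : R * R) : R :=
  euclidean (push phi t s e) (push phi t s f).

(** The orientation is the one for which [(d/dt, d/ds)] is positive. *)
Definition oriented_orthonormal (phi : R -> R -> C * C) (t s : R)
    (e1 e2 : R * R) : Prop :=
  induced_metric phi t s e1 e1 = 1 /\
  induced_metric phi t s e2 e2 = 1 /\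
  induced_metric phi t s e1 e2 = 0 /\
  0 < fst e1 * snd e2 - snd e1 * fst e2.

Definition lagrangian_angle (phi : R -> R -> C * C) (t s beta : R) : Prop :=
  forall e1 e2 : R * R, oriented_orthonormal phi t s e1 e2 ->
    expi beta = detC (push phi t s e1) (push phi t s e2).

Definition product_map (alpha gamma : R -> C * C) (t s : R) : C * C :=
  ((fst (alpha t) * fst (gamma s))%C, (snd (alpha t) * snd (gamma s))%C).

(* Main.v *)
Require Import Defs.
From Stdlib Require Import Reals Lra.
From Coquelicot Require Import Coquelicot.

(** Write E = det (gamma, gamma') and F = det (alpha, alpha'), both of modulus 1.
    In complex dimension two, being Hermitian orthogonal to a nonzero vector
    leaves a complex line, so the Legendre condition determines the velocity of
    each curve from its position and this determinant:
    gamma' = E (- conj gamma_2, conj gamma_1) and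
    alpha' = - F (conj alpha_2, conj alpha_1)
    ([legendre_S3_derive], [legendre_H31_derive]).

    After these velocities are substituted into the partial derivatives of phi,
    the quantity |alpha_2|^2 |gamma_1|^2 + |alpha_1|^2 |gamma_2|^2 governs both
    the metric and the determinant.  Since |alpha_2|^2 = 1 + |alpha_1|^2 and
    |gamma_2|^2 = 1 - |gamma_1|^2, it equals N = |gamma_1|^2 + |alpha_1|^2: the
    metric is N (dt^2 + ds^2) ([euclidean_tangent]), and det (phi_t, phi_s) = - N E F
    ([detC_tangent]).  A positive orthonormal basis of N (dt^2 + ds^2) spans
    coordinate area 1 / N ([orthonormal_area]), hence the determinant of its image
    is - E F, and the sign is the extra pi in the angle.

    The immersion hypothesis gives N > 0, without which there would be no
    orthonormal basis and every number would qualify as a Lagrangian angle; it is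
    what makes the Lagrangian angle determine beta modulo 2 pi. *)

Open Scope R_scope.

(** * Angles modulo 2 pi *)

Lemma expi_plus x y : expi (x + y) = (expi x * expi y)%C.
Proof.
unfold expi, Cmult; simpl; rewrite cos_plus, sin_plus; f_equal; ring.
Qed.

Lemma expi_PI : expi PI = (- RtoC 1)%C.
Proof. unfold expi, RtoC, Copp; simpl; rewrite cos_PI, sin_PI; f_equal; ring. Qed.

Lemma expi_conj x : (expi x * Cconj (expi x))%C = RtoC 1.
Proof.
unfold expi, Cmult, Cconj, RtoC; simpl.
pose proof (sin2_cos2 x) as H; unfold Rsqr in H.
f_equal; [rewrite <- H|]; ring.
Qed.

(** Since 1 - cos d = 2 (sin (d / 2))^2, the equation [expi d = 1] says that
    d / 2 is a zero of the sine. *)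
Lemma expi_eq_iff x y : expi x = expi y <-> eq_mod_2PI x y.
Proof.
split.
- intros H; injection H as Hc Hs.
  assert (Hd : cos (2 * ((x - y) / 2)) = 1).
  { replace (2 * ((x - y) / 2)) with (x - y) by field.
    rewrite cos_minus, Hc, Hs; pose proof (sin2_cos2 y); unfold Rsqr in *; lra. }
  rewrite cos_2a_sin in Hd.
  destruct (sin_eq_0_0 ((x - y) / 2)) as [k Hk]; [nra|].
  exists k; lra.
- intros [k ->].
  assert (Hk : sin (IZR k * PI) = 0) by (apply sin_eq_0_1; exists k; reflexivity).
  replace (2 * PI * IZR k) with (2 * (IZR k * PI)) by ring.
  unfold expi.
  rewrite cos_plus, sin_plus, cos_2a_sin, sin_2a, Hk; f_equal; ring.
Qed.

(** * Derivatives of a product map *)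

Lemma Csmooth_on_ex_derive (I : R -> Prop) f x : Csmooth_on I f -> I x ->
  ex_derive (fun u => Re (f u)) x /\ ex_derive (fun u => Im (f u)) x.
Proof. intros [Hr Hi] Ix; split; [exact (Hr 1%nat x Ix)|exact (Hi 1%nat x Ix)]. Qed.

Lemma ex_derive_mult_const (f : R -> R) c x :
  ex_derive f x -> ex_derive (fun u => f u * c) x.
Proof. intros Hf; apply (ex_derive_mult f (fun _ => c)); [exact Hf|apply ex_derive_const]. Qed.

Lemma CDerive_mult_l (I : R -> Prop) f c x : Csmooth_on I f -> I x ->
  CDerive (fun u => (f u * c)%C) x = (CDerive f x * c)%C.
Proof.
intros Hf Ix; destruct (Csmooth_on_ex_derive I f x Hf Ix) as [Hr Hi].
unfold Re, Im in Hr, Hi; unfold CDerive, Cmult; simpl.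
f_equal; [rewrite Derive_minus|rewrite Derive_plus];
  rewrite ?Derive_scal_l; try reflexivity; apply ex_derive_mult_const; assumption.
Qed.

Lemma CDerive_mult_r (I : R -> Prop) f c x : Csmooth_on I f -> I x ->
  CDerive (fun u => (c * f u)%C) x = (c * CDerive f x)%C.
Proof.
intros Hf Ix; rewrite Cmult_comm, <- (CDerive_mult_l I f c x Hf Ix).
unfold CDerive; f_equal; apply Derive_ext; intros u; rewrite Cmult_comm; reflexivity.
Qed.

(** * Legendre curves as moving frames *)

(** A vector Hermitian orthogonal to a unit vector (g1, g2) is a multiple of
    (- conj g2, conj g1), and the factor is read off from the determinant. *)
Lemma legendre_S3_derive (I : R -> Prop) c s : legendre_S3 I c -> I s ->
  let g1 := fst (c s) in
  let g2 := snd (c s) in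
  let E := detC (c s) (C2Derive c s) in
  (g1 * Cconj g1 + g2 * Cconj g2)%C = RtoC 1 /\
  C2Derive c s = ((- E * Cconj g2)%C, (E * Cconj g1)%C).
Proof.
intros [_ H] Is; specialize (H s Is).
destruct (c s) as [g1 g2], (C2Derive c s) as [d1 d2]; simpl.
unfold detC; simpl.
destruct H as (Hn & _ & Ho).
apply (f_equal RtoC) in Hn; rewrite RtoC_plus, !Cmod2_conj in Hn.
split; [exact Hn|].
assert (H1 : d1 = (d1 * (g1 * Cconj g1 + g2 * Cconj g2))%C) by (rewrite Hn; ring).
assert (H2 : d2 = (d2 * (g1 * Cconj g1 + g2 * Cconj g2))%C) by (rewrite Hn; ring).
f_equal.
- rewrite H1 at 1.
  transitivity (g1 * (d1 * Cconj g1 + d2 * Cconj g2)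
    - (g1 * d2 - d1 * g2) * Cconj g2)%C; [ring|rewrite Ho; ring].
- rewrite H2 at 1.
  transitivity (g2 * (d1 * Cconj g1 + d2 * Cconj g2)
    + (g1 * d2 - d1 * g2) * Cconj g1)%C; [ring|rewrite Ho; ring].
Qed.

(** The same computation for the indefinite Hermitian form: its sign change
    turns the orthogonal direction into (conj a2, conj a1), whose determinant
    with (a1, a2) is |a1|^2 - |a2|^2 = -1, whence the factor - F. *)
Lemma legendre_H31_derive (I : R -> Prop) c t : legendre_H31 I c -> I t ->
  let a1 := fst (c t) in
  let a2 := snd (c t) in
  let F := detC (c t) (C2Derive c t) in
  (a2 * Cconj a2)%C = (RtoC 1 + a1 * Cconj a1)%C /\
  C2Derive c t = ((- F * Cconj a2)%C, (- F * Cconj a1)%C).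
Proof.
intros [_ H] It; specialize (H t It).
destruct (c t) as [a1 a2], (C2Derive c t) as [d1 d2]; simpl.
unfold detC; simpl.
destruct H as (Hn & _ & Ho).
assert (Hn' : (a2 * Cconj a2)%C = (RtoC 1 + a1 * Cconj a1)%C).
{ rewrite <- !Cmod2_conj, <- RtoC_plus; f_equal; lra. }
split; [exact Hn'|].
assert (H1 : d1 = (d1 * (a2 * Cconj a2 - a1 * Cconj a1))%C) by (rewrite Hn'; ring).
assert (H2 : d2 = (d2 * (a2 * Cconj a2 - a1 * Cconj a1))%C) by (rewrite Hn'; ring).
f_equal.
- rewrite H1 at 1.
  transitivity (- a1 * (d1 * Cconj a1 - d2 * Cconj a2)
    - (a1 * d2 - d1 * a2) * Cconj a2)%C; [ring|rewrite Ho; ring].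
- rewrite H2 at 1.
  transitivity (- a2 * (d1 * Cconj a1 - d2 * Cconj a2)
    - (a1 * d2 - d1 * a2) * Cconj a1)%C; [ring|rewrite Ho; ring].
Qed.

(** * The tangent plane of the product surface *)

(** The differential of phi with the two velocities eliminated, so that the
    metric and the determinant become identities between complex numbers. *)
Definition tangent (E F : C) (a g : C * C) (e : R * R) : C * C :=
  ((- RtoC (fst e) * F * Cconj (snd a) * fst g
    - RtoC (snd e) * E * Cconj (snd g) * fst a)%C,
   (- RtoC (fst e) * F * Cconj (fst a) * snd g
    + RtoC (snd e) * E * Cconj (fst g) * snd a)%C).

Lemma push_product_map (I J : R -> Prop) alpha gamma t s e :
  legendre_H31 I alpha -> legendre_S3 J gamma -> I t -> J s ->
  push (product_map alpha gamma) t s e =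
  tangent (detC (gamma s) (C2Derive gamma s)) (detC (alpha t) (C2Derive alpha t))
    (alpha t) (gamma s) e.
Proof.
intros Ha Hg It Js.
destruct (legendre_H31_derive I alpha t Ha It) as [_ Da].
destruct (legendre_S3_derive J gamma s Hg Js) as [_ Dg].
destruct Ha as [[Sa1 Sa2] _], Hg as [[Sg1 Sg2] _].
unfold push, product_map, C2Derive at 1 2 3 4; simpl.
rewrite (CDerive_mult_l I _ _ t Sa1 It), (CDerive_mult_l I _ _ t Sa2 It).
rewrite (CDerive_mult_r J _ _ s Sg1 Js), (CDerive_mult_r J _ _ s Sg2 Js).
change (CDerive (fun u => fst (alpha u)) t) with (fst (C2Derive alpha t)).
change (CDerive (fun u => snd (alpha u)) t) with (snd (C2Derive alpha t)).
change (CDerive (fun u => fst (gamma u)) s) with (fst (C2Derive gamma s)).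
change (CDerive (fun u => snd (gamma u)) s) with (snd (C2Derive gamma s)).
set (E := detC (gamma s) _) in *; set (F := detC (alpha t) _) in *.
rewrite Da, Dg; unfold tangent; simpl.
f_equal; ring.
Qed.

Lemma Cconj_RtoC x : Cconj (RtoC x) = RtoC x.
Proof. unfold Cconj, RtoC; simpl; f_equal; ring. Qed.

(** The identity already holds for the Hermitian product, before real parts are
    taken: the mixed terms phi_t . conj phi_s cancel.  Their imaginary part is
    the Kaehler form, so the surface is Lagrangian as well as conformal. *)
Lemma euclidean_tangent E F a g e f :
  (E * Cconj E)%C = RtoC 1 -> (F * Cconj F)%C = RtoC 1 ->
  (fst g * Cconj (fst g) + snd g * Cconj (snd g))%C = RtoC 1 ->
  (snd a * Cconj (snd a))%C = (RtoC 1 + fst a * Cconj (fst a))%C ->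
  euclidean (tangent E F a g e) (tangent E F a g f) =
  (Cmod (fst g) ^ 2 + Cmod (fst a) ^ 2) * (fst e * fst f + snd e * snd f).
Proof.
intros HE HF Hg Ha.
unfold euclidean, tangent; simpl fst; simpl snd.
match goal with |- _ = ?r => change r with (Re (RtoC r)) end; f_equal.
rewrite RtoC_mult, !RtoC_plus, !Cmod2_conj, !RtoC_mult.
unfold Cminus.
rewrite ?Cplus_conj, ?Copp_conj, ?Cmult_conj, ?Copp_conj, ?Cconj_conj, ?Cconj_RtoC.
destruct a as [a1 a2], g as [g1 g2]; simpl fst in *; simpl snd in *.
assert (Hg2 : (g2 * Cconj g2)%C = (RtoC 1 - g1 * Cconj g1)%C)
  by (rewrite <- Hg; ring).
transitivity
  ((RtoC (fst e) * RtoC (fst f) * (F * Cconj F) + RtoC (snd e) * RtoC (snd f) * (E * Cconj E)) *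
   (a2 * Cconj a2 * (g1 * Cconj g1) + a1 * Cconj a1 * (g2 * Cconj g2)))%C; [ring|].
rewrite HE, HF, Ha, Hg2; ring.
Qed.

Lemma detC_tangent E F a g e f :
  (fst g * Cconj (fst g) + snd g * Cconj (snd g))%C = RtoC 1 ->
  (snd a * Cconj (snd a))%C = (RtoC 1 + fst a * Cconj (fst a))%C ->
  detC (tangent E F a g e) (tangent E F a g f) =
  (RtoC ((Cmod (fst g) ^ 2 + Cmod (fst a) ^ 2)
         * (fst e * snd f - snd e * fst f)) * - (E * F))%C.
Proof.
intros Hg Ha.
unfold detC, tangent; simpl fst; simpl snd.
rewrite RtoC_mult, RtoC_minus, !RtoC_plus, !Cmod2_conj, !RtoC_mult.
destruct a as [a1 a2], g as [g1 g2]; simpl fst in *; simpl snd in *.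
assert (Hg2 : (g2 * Cconj g2)%C = (RtoC 1 - g1 * Cconj g1)%C)
  by (rewrite <- Hg; ring).
transitivity
  ((RtoC (fst e) * RtoC (snd f) - RtoC (snd e) * RtoC (fst f)) * - (E * F) *
   (a2 * Cconj a2 * (g1 * Cconj g1) + a1 * Cconj a1 * (g2 * Cconj g2)))%C; [ring|].
rewrite Ha, Hg2; ring.
Qed.

(** If gamma_1 (s) and alpha_1 (t) both vanish then both partial derivatives
    of phi vanish, since every term of [tangent] contains one of them. *)
Lemma immersion_factor_pos (I J : R -> Prop) alpha gamma t s :
  legendre_H31 I alpha -> legendre_S3 J gamma -> I t -> J s ->
  immersion I J (product_map alpha gamma) ->
  0 < Cmod (fst (gamma s)) ^ 2 + Cmod (fst (alpha t)) ^ 2.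
Proof.
intros Ha Hg It Js Him.
pose proof (pow2_ge_0 (Cmod (fst (gamma s)))) as Pg.
pose proof (pow2_ge_0 (Cmod (fst (alpha t)))) as Pa.
destruct (Rle_lt_or_eq_dec 0 _ (Rplus_le_le_0_compat _ _ Pg Pa)) as [H|H]; [exact H|].
exfalso.
assert (Zg : fst (gamma s) = RtoC 0).
{ apply Cmod_eq_0, Rsqr_0_uniq; rewrite Rsqr_pow2; lra. }
assert (Za : fst (alpha t) = RtoC 0).
{ apply Cmod_eq_0, Rsqr_0_uniq; rewrite Rsqr_pow2; lra. }
assert (He : (1, 0) = (0, 0)).
{ apply (Him t s It Js).
  rewrite (push_product_map I J) by assumption.
  unfold tangent; rewrite Zg, Za; simpl fst; simpl snd.
  rewrite Cconj_RtoC; f_equal; ring. }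
injection He; lra.
Qed.

(** By Lagrange's identity (e x f)^2 + (e . f)^2 = |e|^2 |f|^2, N (e x f) has
    square 1, and the orientation selects the root 1. *)
Lemma orthonormal_area N e f : 0 < N ->
  N * (fst e * fst e + snd e * snd e) = 1 ->
  N * (fst f * fst f + snd f * snd f) = 1 ->
  N * (fst e * fst f + snd e * snd f) = 0 ->
  0 < fst e * snd f - snd e * fst f ->
  N * (fst e * snd f - snd e * fst f) = 1.
Proof.
intros HN He Hf Hef Hpos.
set (A := fst e * snd f - snd e * fst f) in *.
assert (Hsq : (N * A) * (N * A) = 1).
{ transitivity
   ((N * (fst e * fst e + snd e * snd e)) * (N * (fst f * fst f + snd f * snd f))
    - (N * (fst e * fst f + snd e * snd f)) * (N * (fst e * fst f + snd e * snd f)));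
  [unfold A; ring|rewrite He, Hf, Hef; ring]. }
assert (0 < N * A) by (apply Rmult_lt_0_compat; assumption).
nra.
Qed.

Theorem theorem3p4 :
  forall (a1 b1 a2 b2 : Rbar) (gamma alpha : R -> C * C),
    Rbar_lt a1 b1 ->
    Rbar_lt a2 b2 ->
    legendre_S3 (Rbar_interval a1 b1) gamma ->
    legendre_H31 (Rbar_interval a2 b2) alpha ->
    immersion (Rbar_interval a2 b2) (Rbar_interval a1 b1)
      (product_map alpha gamma) ->
    forall t s : R, Rbar_interval a2 b2 t -> Rbar_interval a1 b1 s ->
    forall theta_gamma theta_alpha : R,
      legendre_angle gamma s theta_gamma ->
      legendre_angle alpha t theta_alpha ->
      forall beta : R,
        lagrangian_angle (product_map alpha gamma) t s beta <->
        eq_mod_2PI beta (theta_gamma + theta_alpha + PI).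
Proof.
intros a1 b1 a2 b2 gamma alpha _ _ Hg Ha Him t s It Js thg tha Eg Ea beta.
pose proof (immersion_factor_pos _ _ _ _ t s Ha Hg It Js Him) as HN.
destruct (legendre_S3_derive _ _ _ Hg Js) as [Ng _].
destruct (legendre_H31_derive _ _ _ Ha It) as [Na _].
assert (Hpush := fun e => push_product_map _ _ alpha gamma t s e Ha Hg It Js).
rewrite <- Eg, <- Ea in Hpush.
assert (Hmetric : forall e f, induced_metric (product_map alpha gamma) t s e f =
  (Cmod (fst (gamma s)) ^ 2 + Cmod (fst (alpha t)) ^ 2)
  * (fst e * fst f + snd e * snd f)).
{ intros e f; unfold induced_metric; rewrite !Hpush.
  apply euclidean_tangent; auto using expi_conj. }
set (N := Cmod (fst (gamma s)) ^ 2 + Cmod (fst (alpha t)) ^ 2) in *.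
assert (Hdet : forall e f, oriented_orthonormal (product_map alpha gamma) t s e f ->
  detC (push (product_map alpha gamma) t s e) (push (product_map alpha gamma) t s f)
  = expi (thg + tha + PI)).
{ intros e f (He & Hf & Hef & Hpos); rewrite Hmetric in He, Hf, Hef.
  rewrite !Hpush, detC_tangent by assumption; fold N.
  rewrite (orthonormal_area N e f) by assumption.
  rewrite !expi_plus, expi_PI; ring. }
rewrite <- expi_eq_iff; split.
- intros Hb.
  (* Normalizing the coordinate frame gives a basis to evaluate at. *)
  assert (Hon : oriented_orthonormal (product_map alpha gamma) t s
                  (/ sqrt N, 0) (0, / sqrt N)).
  { assert (Hs : 0 < / sqrt N) by (apply Rinv_0_lt_compat, sqrt_lt_R0, HN).
    assert (Hss : N * (/ sqrt N * / sqrt N) = 1).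
    { rewrite <- (sqrt_sqrt N) at 1 by lra; field.
      apply Rgt_not_eq, sqrt_lt_R0, HN. }
    unfold oriented_orthonormal; rewrite !Hmetric; simpl fst; simpl snd.
    repeat split; nra. }
  rewrite (Hb _ _ Hon); apply Hdet, Hon.
- intros Hb e f Hon; rewrite Hb; symmetry; apply Hdet, Hon.
Qed.
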